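(* Let $\Omega\subset[n_1]\times[n_2]\times[n_3]$ be nonempty and let $Q_{ijk}\in\mathbb{R}\setminus\{0\}$ for $(i,j,k)\in\Omega$. Assume that the homogeneous real linear system $x_1=0$, $y_1=0$, $x_i+y_j+z_k=0$ for $(i,j,k)\in\Omega$, in unknowns $x\in\mathbb{R}^{n_1}$, $y\in\mathbb{R}^{n_2}$, $z\in\mathbb{R}^{n_3}$, has only the zero solution. Consider the real linear system $$x_1=0,\quad y_1=0,\quad x_i+y_j+z_k=\log|Q_{ijk}|,\ (i,j,k)\in\Omega, \qquad (\mathrm{L})$$ and the linear system over the two-element field $GF(2)$ $$\varepsilon_1=0,\quad \nu_1=0,\quad \varepsilon_i+\nu_j+\eta_k=c_{ijk},\ (i,j,k)\in\Omega, \qquad (\mathrm{S})$$ with unknowns $\varepsilon_i,\nu_j,\eta_k\in GF(2)$ ($i\in[n_1]$, $j\in[n_2]$, $k\in[n_3]$), where $c_{ijk}=1$ if $Q_{ijk}>0$ and $c_{ijk}=0$ if $Q_{ijk}<0$. (i) If (L) has no solution, then there is no rank one solution over $\mathbb{R}$. (ii) If (L) has a solution, then a rank one solution over $\mathbb{R}$ exists if and only if (S) has a solution over $GF(2)$; and in that case the rank one solution over $\mathbb{R}$ is unique if and only if (S) has a unique solution over $GF(2)$. (iii) The conditions in (ii), namely whether (S) has a solution and whether that solution is unique, can be checked by Gaussian elimination over $GF(2)$ in time polynomial in the input size.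
   Context: Here $[n]=\{1,\dots,n\}$. Given observed values $Q_{ijk}$, $(i,j,k)\in\Omega$, a rank one solution over $\mathbb{R}$ is a triple of vectors $a\in\mathbb{R}^{n_1}$, $b\in\mathbb{R}^{n_2}$, $c\in\mathbb{R}^{n_3}$ such that $Q_{ijk}=a_ib_jc_k$ for all $(i,j,k)\in\Omega$. Since $(a,b,c)$ is determined by the tensor $a\circ b\circ c$ (with entries $a_ib_jc_k$) only up to rescaling $(\lambda_1a,\lambda_2b,\lambda_3c)$ with $\lambda_1\lambda_2\lambda_3=1$, solutions are normalized by $a_1=1$, $b_1=1$; uniqueness means that there is exactly one normalized solution. The input to (S) consists of $n_1,n_2,n_3$, the index set $\Omega$ and the signs of $Q_{ijk}$, $(i,j,k)\in\Omega$. *)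

(* Defs.v *)
From mathcomp Require Import all_boot all_order all_algebra.
From mathcomp Require Import reals exp.
From Stdlib Require Import (notations) String.

Set Implicit Arguments.
Unset Strict Implicit.
Unset Printing Implicit Defensive.

Import Order.TTheory GRing.Theory Num.Theory.
Local Open Scope ring_scope.

(** * The tensor problem and its linear systems *)

(* The index set [n] is 'I_n; all dimensions are written n.+1, since the
   systems mention x_1 and y_1, which are the entries at ord0. *)
Definition index3 (n1 n2 n3 : nat) : Type := ('I_n1.+1 * 'I_n2.+1 * 'I_n3.+1)%type.

Definition triple (F : Type) (n1 n2 n3 : nat) : Type :=
  ('rV[F]_n1.+1 * 'rV[F]_n2.+1 * 'rV[F]_n3.+1)%type.

(* The values of Q and q outside Omega are irrelevant below. *)
Definition rank_one_solution (R : realType) (n1 n2 n3 : nat)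
    (Omega : {set index3 n1 n2 n3}) (Q : index3 n1 n2 n3 -> R)
    (s : triple R n1 n2 n3) : Prop :=
  let: (a, b, c) := s in
  forall i j k, (i, j, k) \in Omega -> Q (i, j, k) = a 0 i * b 0 j * c 0 k.

Definition normalized (R : realType) (n1 n2 n3 : nat)
    (s : triple R n1 n2 n3) : Prop :=
  let: (a, b, _) := s in a 0 ord0 = 1 /\ b 0 ord0 = 1.

(* x_1 = 0, y_1 = 0, x_i + y_j + z_k = q_ijk for (i,j,k) in Omega *)
Definition linear_solution (F : fieldType) (n1 n2 n3 : nat)
    (Omega : {set index3 n1 n2 n3}) (q : index3 n1 n2 n3 -> F)
    (s : triple F n1 n2 n3) : Prop :=
  let: (x, y, z) := s in
  [/\ x 0 ord0 = 0, y 0 ord0 = 0 &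
      forall i j k, (i, j, k) \in Omega ->
        x 0 i + y 0 j + z 0 k = q (i, j, k)].

Definition system_L (R : realType) (n1 n2 n3 : nat)
    (Omega : {set index3 n1 n2 n3}) (Q : index3 n1 n2 n3 -> R) :=
  linear_solution Omega (fun u => ln `|Q u|).

Definition system_S (R : realType) (n1 n2 n3 : nat)
    (Omega : {set index3 n1 n2 n3}) (Q : index3 n1 n2 n3 -> R) :=
  linear_solution Omega (fun u => if 0 < Q u then 1 else 0 : 'F_2).

(** * A machine model with running times *)

(* A for-loop language over a memory of natural numbers whose cells are
   addressed by a name and two natural numbers.  Every evaluated node of an
   expression, every store, every test and every loop iteration takes one unit
   of time.  There is no unit-cost multiplication or shift, so each step
   lengthens the binary size of the largest stored number by at most one bit
   (or to that of a constant of the program): running times in this model are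
   polynomially equivalent to those of Turing machines. *)

Local Open Scope nat_scope.

Notation string := String.string.

Definition memory := string -> nat -> nat -> nat.

Definition update (s : memory) (a : string) (i j v : nat) : memory :=
  fun a' i' j' =>
    if [&& String.eqb a' a, i' == i & j' == j] then v else s a' i' j'.

Inductive binop := Add | Xor | Eq | Ne | Le | Lt | And.

Inductive expr :=
  | Const of nat
  | Get of string & expr & expr
  | Bin of binop & expr & expr.

Inductive cmd :=
  | Store of string & expr & expr & expr   (* a[i, j] := e *)
  | Seq of cmd & cmd
  | If of expr & cmd
  | For of string & expr & cmd.           (* for x = 0, ..., e - 1 *)

(* Scalar variables are the cells with both coordinates 0. *)
Definition Var (x : string) : expr := Get x (Const 0) (Const 0).
Definition Assign (x : string) (e : expr) : cmd := Store x (Const 0) (Const 0) e.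

(* [Xor] is addition in GF(2) on the bits 0 and 1. *)
Definition eval_binop (o : binop) (x y : nat) : nat :=
  match o with
  | Add => x + y
  | Xor => odd x (+) odd y
  | Eq => x == y
  | Ne => x != y
  | Le => x <= y
  | Lt => x < y
  | And => (x != 0) && (y != 0)
  end.

Fixpoint eval (s : memory) (e : expr) : nat :=
  match e with
  | Const n => n
  | Get a i j => s a (eval s i) (eval s j)
  | Bin o e1 e2 => eval_binop o (eval s e1) (eval s e2)
  end.

Fixpoint cost (e : expr) : nat :=
  match e with
  | Const _ => 1
  | Get _ e1 e2 | Bin _ e1 e2 => (cost e1 + cost e2).+1
  end.

(* Final memory and running time.  The number of iterations of a loop is
   fixed when the loop is entered. *)
Fixpoint run (c : cmd) (s : memory) : memory * nat :=
  match c with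
  | Store a i j e =>
      (update s a (eval s i) (eval s j) (eval s e),
       (cost i + cost j + cost e).+1)
  | Seq c1 c2 =>
      let: (s1, t1) := run c1 s in
      let: (s2, t2) := run c2 s1 in (s2, t1 + t2)
  | If e c1 =>
      if eval s e != 0 then
        let: (s1, t1) := run c1 s in (s1, (cost e + t1).+1)
      else (s, (cost e).+1)
  | For x e c1 =>
      iteri (eval s e)
        (fun i st =>
           let: (s1, t1) := run c1 (update st.1 x 0 0 i) in
           (s1, (st.2 + t1).+1))
        (s, (cost e).+1)
  end.

(** * Gaussian elimination over GF(2) for the system (S) *)

Coercion Const : nat >-> expr.
Coercion Var : string >-> expr.

Declare Scope imp_scope.
Delimit Scope imp_scope with imp.
Bind Scope imp_scope with expr cmd.
Notation "e1 + e2" := (Bin Add e1 e2) : imp_scope.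
Notation "e1 <+> e2" := (Bin Xor e1 e2)
  (at level 50, left associativity) : imp_scope.
Notation "e1 == e2" := (Bin Eq e1 e2) : imp_scope.
Notation "e1 != e2" := (Bin Ne e1 e2) : imp_scope.
Notation "e1 <= e2" := (Bin Le e1 e2) : imp_scope.
Notation "e1 < e2" := (Bin Lt e1 e2) : imp_scope.
Notation "e1 && e2" := (Bin And e1 e2) : imp_scope.
Notation "x ::= e" := (Assign x e) (at level 75, e at level 70) : imp_scope.
Notation "c1 ;; c2" := (Seq c1 c2)
  (at level 85, right associativity) : imp_scope.

Local Open Scope string_scope.

(* Writes the augmented matrix of (S) into the array "A", whose cells are
   initially 0.  Columns 0, ..., N - 1 belong to the unknowns eps, nu, eta in
   this order and column N is the right-hand side; rows 0 and 1 are the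
   equations eps_1 = 0 and nu_1 = 0. *)
Definition build_matrix : cmd := (
  "n1" ::= Get "input" 0 0 ;;
  "n12" ::= "n1" + Get "input" 0 1 ;;
  "N" ::= "n12" + Get "input" 0 2 ;;
  "m" ::= Get "input" 0 3 ;;
  "M" ::= "m" + 2 ;;
  Store "A" 0 0 1 ;;
  Store "A" 1 "n1" 1 ;;
  For "t" "m" (
    Store "A" ("t" + 2) (Get "input" ("t" + 1) 0) 1 ;;
    Store "A" ("t" + 2) ("n1" + Get "input" ("t" + 1) 1) 1 ;;
    Store "A" ("t" + 2) ("n12" + Get "input" ("t" + 1) 2) 1 ;;
    Store "A" ("t" + 2) "N" (Get "input" ("t" + 1) 3)))%imp.

(* "p" is a row at or below "rank" with entry 1 in column "j", or "M" if there
   is none. *)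
Definition find_pivot : cmd := (
  "p" ::= "M" ;;
  For "r" "M" (
    If (("rank" <= "r") && (Get "A" "r" "j" == 1))
      ("p" ::= "r")))%imp.

Definition swap_rows : cmd := (
  For "l" ("N" + 1) (
    "tmp" ::= Get "A" "p" "l" ;;
    Store "A" "p" "l" (Get "A" "rank" "l") ;;
    Store "A" "rank" "l" "tmp"))%imp.

Definition clear_column : cmd := (
  For "r" "M" (
    If (("r" != "rank") && (Get "A" "r" "j" == 1)) (
      For "l" ("N" + 1)
        (Store "A" "r" "l" (Get "A" "r" "l" <+> Get "A" "rank" "l")))))%imp.

Definition eliminate : cmd := (
  "rank" ::= 0 ;;
  For "j" "N" (
    find_pivot ;;
    If ("p" < "M") (
      swap_rows ;;
      clear_column ;;
      "rank" ::= "rank" + 1)))%imp.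

(* The system is inconsistent iff some row "0 = 1" remains, and a consistent
   system has exactly one solution iff every column has a pivot. *)
Definition read_off : cmd := (
  "solvable" ::= 1 ;;
  For "r" "M" (
    If (("rank" <= "r") && (Get "A" "r" "N" == 1))
      ("solvable" ::= 0)) ;;
  "unique" ::= "solvable" && ("rank" == "N"))%imp.

Definition gaussian_elimination : cmd :=
  (build_matrix ;; eliminate ;; read_off)%imp.

(** * Encoding of the input and input size *)

(* The header n_1, n_2, n_3, #|Omega|, then one row i, j, k, c_ijk for every
   element of Omega (with indices counted from 0); [sgn] tells whether
   Q_ijk > 0. *)
Definition input_table (n1 n2 n3 : nat) (Omega : {set index3 n1 n2 n3})
    (sgn : index3 n1 n2 n3 -> bool) : seq (seq nat) :=
  [:: n1.+1; n2.+1; n3.+1; #|Omega|] ::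
  [seq [:: nat_of_ord u.1.1; nat_of_ord u.1.2; nat_of_ord u.2; nat_of_bool (sgn u)]
     | u <- enum Omega].

Definition load (tab : seq (seq nat)) : memory :=
  fun a i j => if String.eqb a "input" then nth 0 (nth [::] tab i) j else 0.

(* Number of binary digits; the number 0 counts as one digit. *)
Definition bit_length (n : nat) : nat := (trunc_log 2 n).+1.

Definition input_size (tab : seq (seq nat)) : nat :=
  \sum_(row <- tab) \sum_(w <- row) bit_length w.

Definition says_solvable (out : memory) : Prop := out "solvable" 0 0 = 1.
Definition says_unique (out : memory) : Prop := out "unique" 0 0 = 1.

(* Main.v *)
Require Import Defs.
From mathcomp Require Import all_boot all_order all_algebra.
From mathcomp Require Import boolp reals sequences exp.
From mathcomp Require Import zify ring.
From Stdlib Require Import (notations) String.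

Set Implicit Arguments.
Unset Strict Implicit.
Unset Printing Implicit Defensive.

Import Order.TTheory GRing.Theory Num.Theory.

(* A normalized rank one solution with nonzero entries is the same thing as a
   solution of (L), its logarithms, together with a solution of (S), its signs;
   triviality of the kernel makes the former unique and forces every index to
   occur in Omega, so that no entry can vanish.  It also gives n1, n2, n3 <=
   #|Omega|: without this the number of unknowns could be exponential in the
   length of the binary input.

   For (iii), the loop invariant of the elimination is a reduced echelon form on
   the processed columns, with the same solutions as the original system; running
   times are bounded by reading off a polynomial from the program text, which is
   sound because no loop modifies the variables that bound the loops inside it. *)

Local Open Scope ring_scope.
Local Open Scope nat_scope.

Local Notation var s x := (s x%string 0 0).

(** * Frame, loop and time rules of the machine *)

Fixpoint writes (c : cmd) (y : string) : bool :=
  match c with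
  | Store a _ _ _ => String.eqb a y
  | Seq c1 c2 => writes c1 y || writes c2 y
  | If _ c1 => writes c1 y
  | For x _ c1 => String.eqb x y || writes c1 y
  end.

Definition agree_off (W : string -> bool) (s s' : memory) : Prop :=
  forall y k l, ~~ W y -> s' y k l = s y k l.

Lemma agree_off_update (W : string -> bool) s s' a i j v :
  W a -> agree_off W s s' -> agree_off W s (update s' a i j v).
Proof.
move=> Wa ss' y k l Wy; rewrite /update.
case: (String.eqb_spec y a) => [ya|_] /=; last exact: ss'.
by rewrite ya Wa in Wy.
Qed.

Lemma agree_off_trans (W : string -> bool) s1 s2 s3 :
  agree_off W s1 s2 -> agree_off W s2 s3 -> agree_off W s1 s3.
Proof. by move=> s12 s23 y k l Wy; rewrite s23 ?s12. Qed.

Lemma agree_off_sub (W W' : string -> bool) s s' :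
  (forall y, W y -> W' y) -> agree_off W s s' -> agree_off W' s s'.
Proof. by move=> WW' ss' y k l W'y; apply: ss'; apply: contra W'y; apply: WW'. Qed.

Lemma run_SeqE c1 c2 s :
  run (Seq c1 c2) s = ((run c2 (run c1 s).1).1,
                       (run c1 s).2 + (run c2 (run c1 s).1).2).
Proof. by rewrite /=; case: (run c1 s) => s1 t1 /=; case: (run c2 s1). Qed.

Lemma run_Seq1E c1 c2 s : (run (Seq c1 c2) s).1 = (run c2 (run c1 s).1).1.
Proof. by rewrite run_SeqE. Qed.

Lemma run_IfE e c s :
  (run (If e c) s).1 = if eval s e != 0 then (run c s).1 else s.
Proof. by rewrite /=; case: ifP => // _; case: (run c s). Qed.

Definition for_step x c (i : nat) (st : memory * nat) : memory * nat :=
  ((run c (update st.1 x 0 0 i)).1, (st.2 + (run c (update st.1 x 0 0 i)).2).+1).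

Lemma run_ForE x e c s :
  run (For x e c) s = iteri (eval s e) (for_step x c) (s, (cost e).+1).
Proof.
rewrite /=; elim: (eval s e) => //= n ->.
by rewrite /for_step; case: (run c _).
Qed.

Lemma run_agree c s : agree_off (writes c) s (run c s).1.
Proof.
elim: c s => [a i j e|c1 IH1 c2 IH2|e c IH|x e c IH] s.
- by apply: agree_off_update => //=; apply: String.eqb_refl.
- rewrite run_SeqE; apply: agree_off_trans (agree_off_sub _ (IH2 _)).
    by apply: agree_off_sub (IH1 s) => y /= ->.
  by move=> y /= ->; rewrite orbT.
- by rewrite run_IfE; case: ifP => // _; apply: IH.
rewrite run_ForE; elim: (eval s e) => //= n IHn.
apply: agree_off_trans (agree_off_sub _ (IH _)).
  by apply: agree_off_update IHn => /=; rewrite String.eqb_refl.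
by move=> y /= ->; rewrite orbT.
Qed.

Lemma run_frame c s y k l : ~~ writes c y -> (run c s).1 y k l = s y k l.
Proof. exact: run_agree. Qed.

(** The invariant rule for loops. The step receives the frame fact [agree_off], so that [P] need not
    repeat that untouched variables keep their initial values. *)
Lemma for_ind x e c s (P : nat -> memory -> Prop) :
  P 0 s ->
  (forall i s', i < eval s e -> agree_off (writes (For x e c)) s s' ->
     P i s' -> P i.+1 (run c (update s' x 0 0 i)).1) ->
  P (eval s e) (run (For x e c) s).1.
Proof.
move=> P0 PS; rewrite run_ForE.
(* The count [n] is detached from the bound, which must stay [eval s e] while the induction runs
   over [k]. *)
set n := eval s e; have: n <= eval s e by [].
suff H k : k <= eval s e ->
    agree_off (writes (For x e c)) s (iteri k (for_step x c) (s, (cost e).+1)).1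
    /\ P k (iteri k (for_step x c) (s, (cost e).+1)).1 by case/H.
elim: k => // k IHk ltk; have [ag Pk] := IHk (ltnW ltk).
split=> /=; last exact: PS.
refine (agree_off_trans _ (agree_off_sub _ (@run_agree c _))).
  by apply: agree_off_update ag => /=; rewrite String.eqb_refl.
by move=> y /= ->; rewrite orbT.
Qed.

Fixpoint reads (e : expr) : seq string :=
  match e with
  | Const _ => [::]
  | Get a i j => a :: reads i ++ reads j
  | Bin _ e1 e2 => reads e1 ++ reads e2
  end.

Lemma eval_agree W s s' e :
  agree_off W s s' -> all (fun y => ~~ W y) (reads e) -> eval s' e = eval s e.
Proof.
move=> ss'; elim: e => //= [a i IHi j IHj|o e1 IH1 e2 IH2].
  by rewrite all_cat => /and3P[Wa /IHi-> /IHj->]; apply: ss'.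
by rewrite all_cat => /andP[/IH1-> /IH2->].
Qed.

Fixpoint loop_bounds (c : cmd) : seq expr :=
  match c with
  | Store _ _ _ _ => [::]
  | Seq c1 c2 => loop_bounds c1 ++ loop_bounds c2
  | If _ c1 => loop_bounds c1
  | For _ e c1 => e :: loop_bounds c1
  end.

(** The variable stands for a common bound on the iteration counts of all loops, so nesting depth
    becomes degree; an [If] is charged as if its test succeeded. *)
Fixpoint time_poly (c : cmd) : {poly nat} :=
  match c with
  | Store _ i j e => ((cost i + cost j + cost e).+1)%:P
  | Seq c1 c2 => time_poly c1 + time_poly c2
  | If e c1 => (cost e).+1%:P + time_poly c1
  | For _ e c1 => (cost e).+1%:P + 'X * (1 + time_poly c1)
  end%R.

(** [W] collects the names that may change during the whole run: a bound reading none of them still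
    has its initial value whenever its loop is entered. *)
Definition steady_bound (W : string -> bool) K s e :=
  all (fun y => ~~ W y) (reads e) && (eval s e <= K).

Lemma steady_agree W K s s' es : agree_off W s s' ->
  all (steady_bound W K s) es -> all (steady_bound W K s') es.
Proof.
move=> ss'; apply: sub_all => e /andP[We leK].
by rewrite /steady_bound We (eval_agree ss').
Qed.

(** The set [W] is a parameter because the induction descends to subcommands, which start after
    other parts of the program have changed names in [W]. *)
Lemma run_time_le (W : string -> bool) K c s :
  (forall y, writes c y -> W y) ->
  all (steady_bound W K s) (loop_bounds c) ->
  (run c s).2 <= (time_poly c).[K]%R.
Proof.
elim: c s => [a i j e|c1 IH1 c2 IH2|e c IH|x e c IH] s cW.
- by move=> _ /=; rewrite hornerC.
- rewrite run_SeqE /= all_cat => /andP[b1 b2].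
  rewrite hornerD leq_add ?IH1 ?IH2 //.
  + by move=> y c1y; apply: cW => /=; rewrite c1y.
  + by move=> y c2y; apply: cW => /=; rewrite c2y orbT.
  apply: steady_agree b2; apply: agree_off_sub (@run_agree c1 s) => y c1y.
  by apply: cW => /=; rewrite c1y.
- move=> /= b; rewrite hornerD hornerC.
  have := IH s cW b; case: ifP => _; last by move=> _; apply: leq_addr.
  by case: (run c s) => s1 t1 /= le; rewrite -addSn leq_add2l.
case/andP=> /andP[We leK] b; rewrite run_ForE /=.
rewrite hornerD hornerC hornerM hornerX hornerD hornerC.
have Wx : W x by apply: cW => /=; rewrite String.eqb_refl.
have Wc y : writes c y -> W y by move=> cy; apply: cW => /=; rewrite cy orbT.
set T := (time_poly c).[K]%R.
suff H k : agree_off W s (iteri k (for_step x c) (s, (cost e).+1)).1 /\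
    (iteri k (for_step x c) (s, (cost e).+1)).2 <= (cost e).+1 + k * (1 + T).
  have [_ le] := H (eval s e); apply: leq_trans le _.
  by rewrite leq_add2l; apply: (leq_mul leK).
elim: k => [|k [ag le]] /=; first by rewrite mul0n addn0.
set s1 := update _ _ _ _ _.
have ag1 : agree_off W s s1 by apply: agree_off_update.
split; first exact: agree_off_trans ag1 (agree_off_sub Wc (@run_agree c _)).
have := IH s1 Wc (steady_agree ag1 b); rewrite -/T => leT.
rewrite mulSn; lia.
Qed.

(** * The steps of the elimination *)

Lemma eval_andE (a b : bool) :
  (eval_binop And (nat_of_bool a) (nat_of_bool b) != 0) = a && b.
Proof. by case: a; case: b. Qed.

(** The scan never stops early, so [p] ends as the last suitable row; the value [M] survives only if
    there was none. *)
Lemma find_pivotP s (p := var (run find_pivot s).1 "p") :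
  (p < var s "M" -> var s "rank" <= p /\ s "A"%string p (var s "j") = 1) /\
  (var s "M" <= p -> forall r, var s "rank" <= r < var s "M" ->
     s "A"%string r (var s "j") != 1).
Proof.
rewrite /p {p} /find_pivot run_Seq1E; set s0 := (run (Assign _ _) s).1.
have frame y k l : ~~ String.eqb "p" y -> s0 y k l = s y k l.
  by move=> py; rewrite /s0 run_frame.
have p0 : var s0 "p" = var s "M" by [].
set loop := For _ _ _.
pose P i (s' : memory) :=
  (var s' "p" < var s "M" ->
     var s "rank" <= var s' "p" /\ s "A"%string (var s' "p") (var s "j") = 1) /\
  (var s "M" <= var s' "p" -> forall r, var s "rank" <= r < i ->
     s "A"%string r (var s "j") != 1).
have : P (eval s0 "M"%string) (run loop s0).1.
  apply: for_ind => [|i s' ltiM ag [P1 P2]].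
    split=> [|_ r]; first by rewrite p0 ltnn.
    by rewrite ltn0 andbF.
  have agv y k l : ~~ writes loop y -> s' y k l = s y k l.
    by move=> wy; rewrite ag // frame //; apply: contra wy => /= ->; rewrite ?orbT.
  rewrite run_IfE /= /update /= !agv //.
  rewrite eval_andE.
  case: ifP => [/andP[leri /eqP Ai]|].
    split; rewrite /= ?frame //= => leM.
    by move: ltiM; rewrite /= frame // ltnNge leM.
  move/negbT => nA; split; first exact: P1.
  move=> leM r /andP[ler]; rewrite ltnS leq_eqVlt => /predU1P[ri|ltri].
    by move: nA; rewrite -ri ler.
  by apply: P2; rewrite ?ler.
by rewrite /P /= frame.
Qed.

Definition swapped (N p q : nat) (A : nat -> nat -> nat) (r l : nat) : nat :=
  if l <= N then A (if r == p then q else if r == q then p else r) l else A r l.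

Lemma swap_rowsP s r l :
  (run swap_rows s).1 "A"%string r l =
  swapped (var s "N") (var s "p") (var s "rank") (s "A"%string) r l.
Proof.
rewrite /swap_rows; set loop := For _ _ _.
pose P i (s' : memory) := forall r l, s' "A"%string r l =
  if l < i then s "A"%string (if r == var s "p" then var s "rank" else
     if r == var s "rank" then var s "p" else r) l else s "A"%string r l.
have : P (eval s ("N"%string + 1)%imp) (run loop s).1.
  apply: for_ind => [|i s' _ ag Pi] // r' l'.
  rewrite /= /update /= !Pi !ag // !ltnn ltnS (leq_eqVlt l').
  case: (eqVneq l' i) => [->|_] /=; rewrite ?ltnn ?andbF //= ?andbT.
  (* When [p] and [rank] coincide the second store wins, and [tmp] restores the original entry. *)
  case: (eqVneq r' (var s "rank")) => [->|_] /=; last by case: ifP.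
  by case: (eqVneq (var s "rank") (var s "p")) => [->|].
by move=> /(_ r l) ->; rewrite /= addn1 ltnS.
Qed.

Definition cleared (M N q j : nat) (A : nat -> nat -> nat) (r l : nat) : nat :=
  if [&& r < M, l <= N, r != q & A r j == 1]
  then nat_of_bool (odd (A r l) (+) odd (A q l)) else A r l.

(** The original matrix suffices on the right: row [rank] is skipped, and any other row changes only
    in its own iteration, after its test was evaluated. *)
Lemma clear_columnP s r l :
  (run clear_column s).1 "A"%string r l =
  cleared (var s "M") (var s "N") (var s "rank") (var s "j") (s "A"%string) r l.
Proof.
rewrite /clear_column; set loop := For _ _ _.
(* The first argument of [cleared] serves as the progress counter of the outer loop. *)
pose P i (s' : memory) := forall r l, s' "A"%string r l =
  cleared i (var s "N") (var s "rank") (var s "j") (s "A"%string) r l.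
have : P (eval s "M"%string) (run loop s).1.
  apply: for_ind => [|i s' ltiM ag Pi] // r' l'; rewrite run_IfE.
  set s1 := update s' _ _ _ _.
  have s1A k m : s1 "A"%string k m = s' "A"%string k m by [].
  have -> : (eval s1 (("r"%string != "rank"%string) &&
     (Get "A" "r"%string "j"%string == 1))%imp != 0) =
     (i != var s "rank") && (s "A"%string i (var s "j") == 1).
    rewrite /= /s1 /update /= !Pi !ag // /cleared ltnn /=.
    exact: eval_andE.
  case: ifP => [/andP[nei /eqP Ai]|nc]; last first.
    rewrite s1A Pi /cleared [r' < i.+1]ltnS [r' <= i]leq_eqVlt.
    by case: (eqVneq r' i) => [->|//] /=; rewrite ltnn nc /= andbF.
  set inner := For _ _ _.
  pose P' k (s' : memory) := forall r l, s' "A"%string r l =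
     if (r == i) && (l < k) then nat_of_bool (odd (s "A"%string r l) (+)
        odd (s "A"%string (var s "rank") l))
     else cleared i (var s "N") (var s "rank") (var s "j") (s "A"%string) r l.
  have ags1 y k m : ~~ writes loop y -> s1 y k m = s y k m.
    move=> wy; rewrite -ag // /s1 /update.
    case: String.eqb_spec => // yr; rewrite yr in wy; done.
  have : P' (eval s1 ("N"%string + 1)%imp) (run inner s1).1.
    apply: for_ind => [|k s2 _ ag2 Pk] r2 l2.
      by rewrite ltn0 andbF s1A Pi.
    have ags2 y m n : ~~ writes loop y -> s2 y m n = s y m n.
      move=> wy; rewrite ag2 ?ags1 //; apply: contra wy => /=.
      by rewrite orbC => ->; rewrite orbT.
    have r2i : var s2 "r" = i by rewrite ag2.
    rewrite /= /update /= r2i !Pk !ags2 // ltnn !andbF /=.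
    rewrite {1 2}/cleared ltnn /= eqxx andbF /=.
    case: (eqVneq r2 i) => [->|_] //=.
    rewrite ltnS (leq_eqVlt l2); case: (eqVneq l2 k) => [->|_] //=.
    by rewrite andbF.
  move=> /(_ r' l') ->; rewrite /= addn1 ltnS ags1 //.
  rewrite /cleared [r' < i.+1]ltnS [r' <= i]leq_eqVlt.
  case: (eqVneq r' i) => [->|_] //=.
  by rewrite ltnn nei Ai /= andbT.
by move=> /(_ r l) ->.
Qed.

(** * Reduced echelon forms over GF(2) *)

Definition solves M N (A : nat -> nat -> nat) (v : 'rV['F_2]_N) : Prop :=
  forall r, r < M ->
    (\sum_(l < N) (A r l)%:R * v 0 l = (A r N)%:R)%R.

Lemma natr_F2_odd n : n%:R = (odd n)%:R :> 'F_2.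
Proof.
rewrite -{1}(odd_double_half n) natrD -muln2 natrM.
by rewrite (_ : 2%:R = 0 :> 'F_2)%R ?mulr0 ?addr0 //; apply: val_inj.
Qed.

Lemma natr_F2_addb a b :
  (nat_of_bool (odd a (+) odd b))%:R = (a%:R + b%:R)%R :> 'F_2.
Proof.
rewrite [in RHS](natr_F2_odd a) [in RHS](natr_F2_odd b).
by case: (odd a); case: (odd b); apply: val_inj.
Qed.

(** Row operations act linearly on residuals, which turns their effect on the solution set into
    arithmetic. *)
Definition residual N (A : nat -> nat -> nat) (v : 'rV['F_2]_N) r : 'F_2 :=
  (\sum_(l < N) (A r l)%:R * v 0 l - (A r N)%:R)%R.

Lemma solvesE M N A (v : 'rV['F_2]_N) :
  solves M A v <-> (forall r, r < M -> residual A v r = 0%R).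
Proof.
split=> S r rM; first by rewrite /residual S // subrr.
by apply/eqP; rewrite -subr_eq0; apply/eqP; apply: S.
Qed.

Lemma residual_swapped N p q A (v : 'rV['F_2]_N) r :
  residual (swapped N p q A) v r =
  residual A v (if r == p then q else if r == q then p else r).
Proof.
rewrite /residual /swapped leqnn; congr (_ - _)%R.
by apply: eq_bigr => l _; rewrite ltnW.
Qed.

Lemma solves_swapped M N p q A (v : 'rV['F_2]_N) : p < M -> q < M ->
  solves M (swapped N p q A) v <-> solves M A v.
Proof.
move=> pM qM; rewrite !solvesE; split=> S r rM; last first.
  by rewrite residual_swapped S //; do 2?case: ifP.
have := S (if r == p then q else if r == q then p else r).
rewrite residual_swapped.
(* A transposition of rows is its own inverse. *)
have -> : (if (if r == p then q else if r == q then p else r) == p then q else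
  if (if r == p then q else if r == q then p else r) == q then p else
  (if r == p then q else if r == q then p else r)) = r.
  case: (eqVneq r p) => [->|rp] /=.
    by case: (eqVneq q p) => [->|_] //; rewrite eqxx.
  case: (eqVneq r q) => [->|rq]; first by rewrite eqxx.
  by rewrite (negPf rp) (negPf rq).
by apply; do 2?case: ifP.
Qed.

Lemma residual_cleared M N q j A (v : 'rV['F_2]_N) r : r < M ->
  residual (cleared M N q j A) v r =
  (residual A v r + ((r != q) && (A r j == 1))%:R * residual A v q)%R.
Proof.
move=> rM; rewrite /residual /cleared rM leqnn /=.
case: (boolP (_ && _)) => [_|_] /=; last first.
  rewrite mul0r addr0; congr (_ - _)%R.
  by apply: eq_bigr => l _; rewrite andbF.
rewrite mul1r addrACA -opprD natr_F2_addb -big_split /=; congr (_ - _)%R.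
by apply: eq_bigr => l _; rewrite ltnW //= natr_F2_addb mulrDl.
Qed.

(** Row [q] is untouched, so its residual vanishes for solutions of either system, and the other
    residuals change only by multiples of it. *)
Lemma solves_cleared M N q j A (v : 'rV['F_2]_N) : q < M ->
  solves M (cleared M N q j A) v <-> solves M A v.
Proof.
move=> qM; rewrite !solvesE; split=> S r rM; last first.
  by rewrite residual_cleared // !S // mulr0 addr0.
have Sq : residual A v q = 0%R.
  by have := S q qM; rewrite residual_cleared // eqxx mul0r addr0.
by have := S r rM; rewrite residual_cleared // Sq mulr0 addr0.
Qed.

(** Reduced echelon form of the first [j] columns: [piv] sends a row to its pivot column, and its
    size is the rank reached so far. Distinctness of the pivots replaces the staircase order. *)
Record reduced M N (A : nat -> nat -> nat) j (piv : seq nat) : Prop := Reduced {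
  reduced_bit : forall r l, A r l <= 1;
  reduced_size : size piv <= M;
  reduced_uniq : uniq piv;
  reduced_lt : forall l, l \in piv -> l < j;
  reduced_le : j <= N;
  reduced_pivots : forall r r', r < size piv -> r' < M ->
    A r' (nth 0 piv r) = (r' == r);
  reduced_zero : forall r l, size piv <= r < M -> l < j -> A r l = 0 }.

Lemma reduced_no_pivot M N A j piv : reduced M N A j piv -> j < N ->
  (forall r, size piv <= r < M -> A r j != 1) -> reduced M N A j.+1 piv.
Proof.
case=> bit sz un lt le pv z jN nop; split=> //.
  by move=> l /lt /leqW.
move=> r l rM; rewrite ltnS leq_eqVlt => /predU1P[->|]; last exact: z.
by have := nop r rM; have := bit r j; case: (A r j) => [|[]].
Qed.

(** Both swapped rows have index at least [q], hence vanish on the columns before [j]; adding the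
    new pivot row therefore disturbs no earlier pivot column and no earlier zero. *)
Lemma reduced_pivot M N A j piv p (q := size piv) :
  reduced M N A j piv -> j < N -> q <= p < M -> A p j = 1 ->
  reduced M N (cleared M N q j (swapped N p q A)) j.+1 (rcons piv j).
Proof.
rewrite /q {q}; set q := size piv => red jN /andP[qp pM] Apj.
have [bit sz un lt le pv z] := red.
have qM : q < M by apply: leq_ltn_trans pM.
set B := swapped N p q A.
have Bbit r l : B r l <= 1 by rewrite /B /swapped; case: ifP.
have Bpv r r' : r < q -> r' < M -> B r' (nth 0 piv r) = (r' == r).
  move=> rq r'M; have lj := lt _ (mem_nth 0 rq).
  rewrite /B /swapped (ltnW (ltn_trans lj jN)).
  have nqr : (q == r) = false by apply/eqP; lia.
  have npr : (p == r) = false by apply/eqP; lia.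
  case: (eqVneq r' p) => [->|_]; first by rewrite pv // nqr npr.
  case: (eqVneq r' q) => [->|_]; first by rewrite pv // nqr npr.
  exact: pv.
have Bz r l : q <= r < M -> l < j -> B r l = 0.
  move=> /andP[qr rM] lj; rewrite /B /swapped (ltnW (ltn_trans lj jN)).
  case: ifP => _; first by rewrite z // leqnn.
  by case: ifP => _; rewrite z // ?qp ?qr.
have Bqj : B q j = 1.
  by rewrite /B /swapped (ltnW jN) eqxx; case: eqP => [->|_].
clearbody B.
set C := cleared _ _ _ _ _.
have Cj r : r < M -> C r j = (r == q).
  move=> rM; rewrite /C /cleared rM (ltnW jN) /=.
  case: (eqVneq r q) => [->|nrq] /=; first by rewrite Bqj.
  case: eqP => [->|]; first by rewrite Bqj.
  by have := Bbit r j; case: (B r j) => [|[]].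
split.
- by move=> r l; rewrite /C /cleared; case: ifP => // _; case: (odd _ (+) _).
- by rewrite size_rcons.
- rewrite rcons_uniq un andbT; apply/negP => /lt; lia.
- by move=> l; rewrite mem_rcons inE => /predU1P[->|/lt /leqW].
- by [].
- move=> r r'; rewrite size_rcons ltnS leq_eqVlt nth_rcons -/q.
  case/predU1P => [-> r'M|rq r'M]; first by rewrite ltnn eqxx Cj.
  rewrite rq /C /cleared.
  have [nqr lj] : (q == r) = false /\ nth 0 piv r < j.
    by split; [apply/eqP; lia | apply/lt/mem_nth].
  case: ifP => [_|_]; last exact: Bpv.
  by rewrite !Bpv // nqr addbF oddb.
- move=> r l; rewrite size_rcons -/q => /andP[qr rM].
  rewrite ltnS leq_eqVlt => /predU1P[->|lj].
    by rewrite Cj //; apply/eqP; rewrite eqb0; apply/eqP; lia.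
  rewrite /C /cleared; case: ifP => _; rewrite !Bz ?leqnn ?rM ?(ltnW qr) //.
Qed.

Definition consistent M N (A : nat -> nat -> nat) k : Prop :=
  forall r, k <= r < M -> A r N = 0.

Section ReducedSolutions.
Variables (M N : nat) (A : nat -> nat -> nat) (piv : seq nat).
Hypothesis red : reduced M N A N piv.

Local Notation q := (size piv).

(* The pivot columns act as the identity, so prescribing the pivot unknowns by
   a column [k] and letting the other unknowns vanish reproduces that column. *)
Definition pivot_vector k : 'rV['F_2]_N :=
  \row_l (if (l : nat) \in piv then (A (index (l : nat) piv) k)%:R else 0)%R.

(** Among the pivot columns a row [r < q] has a single entry 1; the rows from [q] on are zero on all
    unknowns, whence the side condition on column [k]. *)
Lemma pivot_vectorE k r : r < M -> (r < q \/ A r k = 0) ->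
  (\sum_(l < N) (A r l)%:R * pivot_vector k 0 l = (A r k)%:R)%R.
Proof.
have [bit sz un lt le pv z] := red; move=> rM.
have off (l : 'I_N) : (l : nat) \in piv -> A r l = (r == index (l : nat) piv).
  by move=> lp; rewrite -{1}(nth_index 0 lp) pv // index_mem.
have [rq _|qr [//|Ark]] := ltnP r q; last first.
  rewrite Ark big1 // => l _; rewrite z ?mul0r ?qr //.
pose l0 := Ordinal (lt _ (mem_nth 0 rq)).
rewrite (bigD1 l0) //= !mxE mem_nth // pv // eqxx mul1r index_uniq //.
rewrite big1 ?addr0 // => l nl; rewrite mxE.
case: ifP => [lp|_]; last by rewrite mulr0.
rewrite off //; case: eqP => [er|_]; last by rewrite mul0r.
by case/eqP: nl; apply: val_inj; rewrite /= er nth_index.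
Qed.

Lemma reduced_solvable :
  (exists v : 'rV['F_2]_N, solves M A v) <-> consistent M N A q.
Proof.
have [bit sz un lt le pv z] := red; split=> [[v S] r rM|cons].
  have /andP[_ rM'] := rM; have := S r rM'.
  rewrite big1 => [|l _]; last by rewrite z ?mul0r.
  by have := bit r N; case: (A r N) => [|[]] // _ /(congr1 val).
exists (pivot_vector N) => r rM; apply: pivot_vectorE => //.
by have [|qr] := ltnP r q; [left | right; apply: cons; rewrite qr].
Qed.

(** With fewer than [N] pivots a free column yields a kernel vector and so a second solution; with
    [N] pivots the coefficients form a permutation matrix up to zero rows, and each unknown is read
    off. *)
Lemma reduced_unique :
  (exists! v : 'rV['F_2]_N, solves M A v) <-> consistent M N A q /\ q = N.
Proof.
have [bit sz un lt le pv z] := red.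
have le_qN : q <= N.
  rewrite -(size_iota 0 N); apply: uniq_leq_size => // l /lt.
  by rewrite mem_iota.
split=> [[v [S U]]|[/reduced_solvable[v S] qN]].
  have cons : consistent M N A q by apply/reduced_solvable; exists v.
  split=> //; apply/eqP; rewrite eqn_leq le_qN leqNgt; apply/negP => ltqN.
  have /allPn[f f_lt /negPf fp] : ~~ all (mem piv) (iota 0 N).
    apply/negP => /allP sub; move: ltqN; rewrite ltnNge -{1}(size_iota 0 N).
    by rewrite uniq_leq_size ?iota_uniq.
  rewrite mem_iota /= add0n in f_lt; rewrite /= in fp.
  (* The free unknown [f] is set to 1 and its column is cancelled by the pivot unknowns; over GF(2)
     no sign appears. *)
  pose w : 'rV['F_2]_N := (delta_mx 0 (Ordinal f_lt) + pivot_vector f)%R.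
  have Sw : solves M A (v + w)%R.
    move=> r rM; have kw : (\sum_(l < N)
        (A r l)%:R * w 0 l = 0 :> 'F_2)%R.
      under eq_bigr do rewrite mxE mulrDr.
      rewrite big_split /= pivot_vectorE //; last first.
        by have [|qr] := ltnP r q; [left | right; apply: z; rewrite ?qr].
      rewrite (bigD1 (Ordinal f_lt)) //= mxE !eqxx mulr1 big1 ?addr0.
        by rewrite -natr_F2_addb addbb.
      by move=> l nl; rewrite mxE (negPf nl) andbF mulr0.
    under eq_bigr do rewrite mxE mulrDr.
    by rewrite big_split /= kw addr0 S.
  (* Coordinate [f] of [w] is 1, as [f] is not a pivot, which contradicts [v = v + w]. *)
  have /matrixP/(_ 0 (Ordinal f_lt))%R := U _ Sw.
  rewrite !mxE !eqxx fp addr0 -[LHS]addr0 => /addrI/esym/eqP.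
  by rewrite oner_eq0.
exists v; split=> // w Sw; apply/rowP => l.
have all_piv (k : 'I_N) : (k : nat) \in piv.
  have sub : {subset piv <= iota 0 N} by move=> i /lt; rewrite mem_iota.
  have [|_ ->] := uniq_min_size un sub; first by rewrite size_iota qN.
  by rewrite mem_iota /=.
have value (u : 'rV['F_2]_N) : solves M A u ->
    u 0%R l = (A (index (l : nat) piv) N)%:R%R.
  move=> Su; have iq : index (l : nat) piv < q by rewrite index_mem.
  rewrite -(Su _ (leq_trans iq sz)) (bigD1 l) //=.
  have off (k : 'I_N) :
      A (index (l : nat) piv) k = (index (l : nat) piv == index (k : nat) piv).
    by rewrite -{1}(nth_index 0 (all_piv k)) pv ?index_mem ?(leq_trans iq sz).
  rewrite off eqxx mul1r big1 ?addr0 // => k nk.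
  rewrite off; case: eqP => [e|_]; last by rewrite mul0r.
  case/eqP: nk; apply: val_inj => /=.
  by rewrite -(nth_index 0 (all_piv k)) -e nth_index.
by rewrite !value.
Qed.

End ReducedSolutions.

(** * Correctness of the elimination loop and of the final tests *)

Lemma solves_ext M N A B (v : 'rV['F_2]_N) :
  (forall r l, A r l = B r l) -> solves M A v <-> solves M B v.
Proof.
by move=> AB; split=> S r rM; have := S r rM; rewrite ?AB => eS;
  rewrite -eS; apply: eq_bigr => l _; rewrite AB.
Qed.

Lemma reduced_ext M N A B j piv :
  (forall r l, A r l = B r l) -> reduced M N A j piv -> reduced M N B j piv.
Proof.
move=> AB [bit sz un lt le pv z]; split=> // r l; rewrite -AB.
- exact: bit.
- exact: pv.
- exact: z.
Qed.

Lemma cleared_ext M N q j A B r l :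
  (forall r l, A r l = B r l) -> cleared M N q j A r l = cleared M N q j B r l.
Proof. by move=> AB; rewrite /cleared !AB. Qed.

Lemma eliminateP s (s' := (run eliminate s).1) (M := var s "M") (N := var s "N") :
  (forall r l, s "A"%string r l <= 1) ->
  exists piv, [/\ reduced M N (s' "A"%string) N piv, var s' "rank" = size piv &
    forall v : 'rV['F_2]_N, solves M (s' "A"%string) v <-> solves M (s "A"%string) v].
Proof.
move=> bit; rewrite /s' /eliminate run_Seq1E; set s0 := (run _ s).1.
set loop := For _ _ _.
pose P j (s' : memory) := exists piv,
  [/\ reduced M N (s' "A"%string) j piv, var s' "rank" = size piv &
    forall v : 'rV['F_2]_N, solves M (s' "A"%string) v <-> solves M (s "A"%string) v].
suff PN : P (eval s0 "N"%string) (run loop s0).1 by exact: PN.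
apply: for_ind => [|j s1 ltjN ag [piv [red rk sol]]].
  by exists [::]; split=> //; split=> //= r l; apply: bit.
rewrite run_Seq1E; set s2 := update s1 _ _ _ _; set s3 := (run find_pivot s2).1.
have jN : j < N by [].
have s3M : var s3 "M" = M by rewrite /s3 run_frame //= /s2 /update /= ag.
have s3N : var s3 "N" = N by rewrite /s3 run_frame //= /s2 /update /= ag.
have s3rk : var s3 "rank" = size piv by rewrite /s3 run_frame //= -rk.
have s3j : var s3 "j" = j by rewrite /s3 run_frame.
have s3A r l : s3 "A"%string r l = s1 "A"%string r l by rewrite /s3 run_frame.
have s2M : var s2 "M" = M by rewrite /s2 /update /= ag.
have [] := find_pivotP s2; rewrite -/s3 s2M.
rewrite (_ : var s2 "rank" = size piv) // (_ : var s2 "j" = j) //.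
rewrite (_ : s2 "A"%string = s1 "A"%string) // => yes no.
rewrite run_IfE (_ : eval s3 _ = (var s3 "p" < M)); last by rewrite /= s3M.
rewrite eqb0 negbK; case: ltnP => [pM|Mp]; last first.
  exists piv; rewrite s3rk; split=> //.
    by apply: (reduced_ext (fun r l => esym (s3A r l))); apply: reduced_no_pivot (no Mp).
  by move=> v; rewrite -sol; apply: solves_ext.
have [qp Apj] := yes pM.
rewrite !run_Seq1E; set s4 := (run swap_rows s3).1; set s5 := (run clear_column s4).1.
set s6 := (run _ s5).1; set p := var s3 "p"; set q := size piv.
have s6A r l : s6 "A"%string r l =
    cleared M N q j (swapped N p q (s1 "A"%string)) r l.
  rewrite (_ : s6 "A"%string r l = s5 "A"%string r l) //.
  rewrite /s5 clear_columnP /s4 !run_frame // s3M s3N s3rk s3j -/q.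
  apply: cleared_ext => r' l'; rewrite /s4 swap_rowsP s3N s3rk.
  by rewrite /swapped !s3A.
have s6rk : var s6 "rank" = (size piv).+1.
  rewrite (_ : var s6 "rank" = var s5 "rank" + 1) //.
  by rewrite /s5 run_frame // /s4 run_frame // s3rk addn1.
exists (rcons piv j); rewrite s6rk size_rcons; split=> //.
  apply: (reduced_ext (fun r l => esym (s6A r l))).
  by apply: reduced_pivot; rewrite // qp.
move=> v; rewrite -sol (solves_ext _ _ s6A) solves_cleared ?(leq_ltn_trans qp) //.
by rewrite solves_swapped ?(leq_ltn_trans qp).
Qed.

Lemma read_offP s (s' := (run read_off s).1) :
  (forall r l, s "A"%string r l <= 1) ->
  (says_solvable s' <->
     consistent (var s "M") (var s "N") (s "A"%string) (var s "rank")) /\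
  (says_unique s' <->
     consistent (var s "M") (var s "N") (s "A"%string) (var s "rank") /\
     var s "rank" = var s "N").
Proof.
move=> bit; rewrite /s' {s'} /read_off !run_Seq1E; set s0 := (run _ s).1.
set loop := For _ _ _.
(* The bound leaves only the values 0 and 1 for [solvable], whereas the final conjunction merely
   tests it for being nonzero. *)
pose P i (s' : memory) := var s' "solvable" <= 1 /\ (var s' "solvable" = 1 <->
  consistent i (var s "N") (s "A"%string) (var s "rank")).
have : P (eval s0 "M"%string) (run loop s0).1.
  apply: for_ind => [|i s1 ltiM ag [le1 Pi]].
    by split=> //; split=> // _ r; rewrite ltn0 andbF.
  rewrite run_IfE; set s2 := update _ _ _ _ _.
  rewrite (_ : eval s2 _ = eval_binop And (var s "rank" <= i)
    (s "A"%string i (var s "N") == 1)).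
    rewrite eval_andE; case: ifP => [/andP[ri /eqP Ai]|nA].
      split=> //; split=> [//|/(_ i)]; rewrite ri ltnSn Ai.
      by move=> /(_ isT).
    rewrite /P (_ : var s2 "solvable" = var s1 "solvable") //; split=> //.
    rewrite Pi; split=> cons r /andP[rr ri]; last first.
      by apply: cons; rewrite rr ltnW.
    move: ri; rewrite ltnS leq_eqVlt => /predU1P[eri|ltri].
      rewrite -eri rr /= in nA.
      by have := bit r (var s "N"); case: (s "A"%string r _) nA => [|[]].
    by apply: cons; rewrite rr.
  by rewrite /= /s2 /update /= !ag.
rewrite (_ : eval s0 _ = var s "M") //; set s1 := (run loop s0).1.
move=> [le1 solv]; set s2 := (run _ s1).1.
split; first by rewrite -solv.
have rkE : var s1 "rank" = var s "rank" by rewrite /s1 run_frame.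
have NE : var s1 "N" = var s "N" by rewrite /s1 run_frame.
rewrite /says_unique (_ : var s2 "unique" =
   eval_binop And (var s1 "solvable") (var s1 "rank" == var s1 "N")) //.
rewrite rkE NE -solv; move: le1; case: (var s1 "solvable") => [|[|//]] _.
  by split=> [|[]].
by case: eqP => /= e; split=> // -[].
Qed.

(** * The matrix of (S) *)

Section SignSystem.
Variables (n1 n2 n3 : nat) (Omega : {set index3 n1 n2 n3}).
Variable sgn : index3 n1 n2 n3 -> bool.

Local Notation N := (n1.+1 + n2.+1 + n3.+1).
Local Notation M := (#|Omega| + 2).
Local Notation u_ t := (nth (ord0, ord0, ord0) (enum Omega) t).
Local Notation input := (load (input_table Omega sgn)).

(** The three indices fall in disjoint blocks of columns, so a disjunction encodes the sum of three
    unknowns. Rows past the last equation read the default of [nth]; [build_matrixP] masks them. *)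
Definition sign_matrix (r l : nat) : nat :=
  match r with
  | 0 => l == 0
  | 1 => l == n1.+1
  | t.+2 =>
      if l == N then sgn (u_ t)
      else [|| l == (u_ t).1.1, l == n1.+1 + (u_ t).1.2 | l == n1.+1 + n2.+1 + (u_ t).2]
  end.

Lemma build_matrixP (s := (run build_matrix input).1) :
  [/\ var s "N" = N, var s "M" = M &
      forall r l, s "A"%string r l = if r < M then sign_matrix r l else 0].
Proof.
rewrite /s {s} /build_matrix; set loop := For _ _ _.
rewrite !run_Seq1E; set s0 := (run (Store "A"%string _ _ _) _).1.
have s0input k l : s0 "input"%string k l = input "input"%string k l by [].
have [s0n1 s0n12] : var s0 "n1" = n1.+1 /\ var s0 "n12" = n1.+1 + n2.+1 by [].
have [s0N s0m] : var s0 "N" = N /\ var s0 "m" = #|Omega| by [].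
have s0M : var s0 "M" = M by [].
have s0A r l : s0 "A"%string r l = if r < 2 then sign_matrix r l else 0.
  have -> : s0 "A"%string r l = if (r == 1) && (l == n1.+1) then 1 else
      if (r == 0) && (l == 0) then 1 else 0 by [].
  by case: r => [|[|r]] //=; case: (l == _).
clearbody s0; split; rewrite ?run_frame //.
pose P t (s' : memory) := forall r l,
  s' "A"%string r l = if r < t + 2 then sign_matrix r l else 0.
have : P (eval s0 "m"%string) (run loop s0).1.
  apply: for_ind => [//|t s1 ltt ag IH] r l.
  have tm : t < size (enum Omega) by rewrite -cardE -s0m.
  (* Row 0 of the input is the header, so element [t] of the enumeration sits in input row [t + 1],
     and its equation in matrix row [t + 2]. *)
  have row k : s1 "input"%string (t + 1) k = nth 0
      [:: nat_of_ord (u_ t).1.1; nat_of_ord (u_ t).1.2; nat_of_ord (u_ t).2;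
          nat_of_bool (sgn (u_ t))] k.
    by rewrite ag // s0input /load /= addn1 /= (nth_map (ord0, ord0, ord0)).
  rewrite !run_Seq1E /= /update /= !IH !row !ag // s0n1 s0n12 s0N /=.
  rewrite addSn ltnS [r <= _]leq_eqVlt.
  case: (eqVneq r (t + 2)) => [->|//] /=; rewrite ltnn addn2 /=.
  case: (l == N) => //.
  by case: (l == _) => //; case: (l == _) => //; case: (l == _).
by move=> PS r l; rewrite PS /= s0m.
Qed.

Lemma sign_matrix_bit r l : sign_matrix r l <= 1.
Proof.
by case: r => [|[|r]] /=; rewrite ?leq_b1 //; case: ifP => _; apply: leq_b1.
Qed.

Local Open Scope ring_scope.

Definition concat_triple (s : triple 'F_2 n1 n2 n3) : 'rV['F_2]_N :=
  row_mx (row_mx s.1.1 s.1.2) s.2.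

Definition split_row (v : 'rV['F_2]_N) : triple 'F_2 n1 n2 n3 :=
  (lsubmx (lsubmx v), rsubmx (lsubmx v), rsubmx v).

Lemma concat_tripleK : cancel concat_triple split_row.
Proof.
by case=> -[x y] z; rewrite /split_row /concat_triple /= !row_mxKl !row_mxKr.
Qed.

Lemma split_rowK : cancel split_row concat_triple.
Proof. by move=> v; rewrite /concat_triple /= !hsubmxK. Qed.

Lemma sum_pick (v : 'rV['F_2]_N) (k : 'I_N) :
  \sum_(l < N) ((l : nat) == k)%:R * v 0 l = v 0 k.
Proof.
rewrite (bigD1 k) //= eqxx mul1r big1 ?addr0 // => l nlk.
by rewrite (_ : (l : nat) == k = (l == k)) // (negPf nlk) mul0r.
Qed.

Lemma solves_sign_matrix (s : triple 'F_2 n1 n2 n3) :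
  solves M sign_matrix (concat_triple s) <->
  linear_solution Omega (fun u => (sgn u)%:R) s.
Proof.
case: s => -[x y] z; set v := concat_triple _.
pose c1 i : 'I_N := lshift n3.+1 (lshift n2.+1 i).
pose c2 j : 'I_N := lshift n3.+1 (rshift n1.+1 j).
pose c3 k : 'I_N := rshift (n1.+1 + n2.+1) k.
have vx i : v 0 (c1 i) = x 0 i by rewrite /v /concat_triple !row_mxEl.
have vy j : v 0 (c2 j) = y 0 j by rewrite /v /concat_triple row_mxEl row_mxEr.
have vz k : v 0 (c3 k) = z 0 k by rewrite /v /concat_triple row_mxEr.
have row0 : \sum_(l < N) (sign_matrix 0 l)%:R * v 0 l = x 0 ord0.
  by rewrite -vx -sum_pick.
have row1 : \sum_(l < N) (sign_matrix 1 l)%:R * v 0 l = y 0 ord0.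
  rewrite -vy -sum_pick; apply: eq_bigr => l _; congr (_%:R * _).
  by rewrite /= addn0.
have row2 t : \sum_(l < N) (sign_matrix t.+2 l)%:R * v 0 l =
    x 0 (u_ t).1.1 + y 0 (u_ t).1.2 + z 0 (u_ t).2.
  rewrite -vx -vy -vz -!sum_pick -!big_split /=; apply: eq_bigr => l _.
  (* Every unknown has its column below [N], and the ranges of the blocks exclude two simultaneous
     hits, so the disjunction equals the sum of the indicators. *)
  rewrite -!mulrDl ltn_eqF ?ltn_ord //; congr (_ * _).
  have := ltn_ord (u_ t).1.1; have := ltn_ord (u_ t).1.2.
  case: eqP => [->|_]; case: eqP => [e|_]; case: eqP => [e'|_] //=;
    rewrite ?addr0 ?add0r //; lia.
have N_neq : (N == n1.+1) = false by apply/eqP; lia.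
split=> [S|[x0 y0 S] [|[|t]] rM].
- split.
  + by rewrite -row0 S //= addn2.
  + by rewrite -row1 S ?addn2 //= N_neq.
  + move=> i j k ijk; have ltm : (index (i, j, k) (enum Omega) < #|Omega|)%N.
      by rewrite cardE index_mem mem_enum.
    have := S (index (i, j, k) (enum Omega)).+2; rewrite addn2 => /(_ ltm).
    by rewrite row2 /= eqxx nth_index ?mem_enum.
- by rewrite row0 x0.
- by rewrite row1 y0 /= N_neq.
- rewrite row2 /= eqxx S -?surjective_pairing //.
  by rewrite -mem_enum mem_nth // -cardE; move: rM; rewrite addn2.
Qed.

Lemma gaussian_eliminationP (s := (run gaussian_elimination input).1) :
  (says_solvable s <->
     exists v, linear_solution Omega (fun u => (sgn u)%:R : 'F_2) v) /\
  (says_unique s <->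
     exists! v, linear_solution Omega (fun u => (sgn u)%:R : 'F_2) v).
Proof.
rewrite /s {s} (run_Seq1E build_matrix) (run_Seq1E eliminate).
set s1 := (run build_matrix _).1; set s2 := (run eliminate s1).1.
have [s1N s1M s1A] := build_matrixP; rewrite -/s1 in s1N s1M s1A.
have bit1 r l : (s1 "A"%string r l <= 1)%N.
  by rewrite s1A; case: ifP => // _; apply: sign_matrix_bit.
have := eliminateP bit1; rewrite -/s2 s1N s1M => -[piv [red rk sol]].
have solE v : solves M (s2 "A"%string) v <->
    linear_solution Omega (fun u => (sgn u)%:R) (split_row v).
  rewrite sol -solves_sign_matrix split_rowK.
  by split=> S r rM; have := S r rM; rewrite s1A rM => eS;
    rewrite -eS; apply: eq_bigr => l _; rewrite s1A rM.
have [solv uniq] := read_offP (reduced_bit red).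
have s2M : s2 "M"%string 0 0 = M by rewrite /s2 run_frame.
have s2N : s2 "N"%string 0 0 = N by rewrite /s2 run_frame.
rewrite s2M s2N rk in solv uniq; split.
  rewrite solv -(reduced_solvable red); split=> -[v S].
    by exists (split_row v); apply/solE.
  by exists (concat_triple v); apply/solE; rewrite concat_tripleK.
rewrite uniq -(reduced_unique red); split=> -[v [S U]].
  exists (split_row v); split; first exact/solE.
  move=> w Sw; rewrite -[w]concat_tripleK; congr split_row; apply: U.
  by apply/solE; rewrite concat_tripleK.
exists (concat_triple v); split; first by apply/solE; rewrite concat_tripleK.
by move=> w /solE/U ->; rewrite split_rowK.
Qed.

End SignSystem.

(** * Running time against input size *)

Lemma run_time_Seq K c1 c2 s :
  (run c1 s).2 <= (time_poly c1).[K]%R ->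
  (run c2 (run c1 s).1).2 <= (time_poly c2).[K]%R ->
  (run (Seq c1 c2) s).2 <= (time_poly (Seq c1 c2)).[K]%R.
Proof. by move=> le1 le2; rewrite run_SeqE /= hornerD leq_add. Qed.

Section Time.
Variables (n1 n2 n3 : nat) (Omega : {set index3 n1 n2 n3}).
Variable sgn : index3 n1 n2 n3 -> bool.

Local Notation N := (n1.+1 + n2.+1 + n3.+1).
Local Notation M := (#|Omega| + 2).
Local Notation input := (load (input_table Omega sgn)).

Lemma gaussian_elimination_time K : N < K -> M <= K ->
  (run gaussian_elimination input).2 <= (time_poly gaussian_elimination).[K]%R.
Proof.
move=> NK MK.
have static c s : all (steady_bound (writes c) K s) (loop_bounds c) ->
    (run c s).2 <= (time_poly c).[K]%R by apply: run_time_le.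
have [] := build_matrixP Omega sgn; set s1 := (run build_matrix _).1 => s1N s1M _.
(* The program itself computes [M] and [N], so loop bounds are not steady over the whole run; it is
   cut into phases within which they are. *)
apply: run_time_Seq; last apply: run_time_Seq.
- rewrite /build_matrix.
  (* Seven loop-free instructions precede the loop; its bound [m] is set only by one of them. *)
  do 7![apply: run_time_Seq; first exact: static].
  apply: static; set s := (run _ _).1.
  rewrite /= /steady_bound /= (_ : var s "m" = #|Omega|) //; lia.
- by apply: static; rewrite -/s1 /= /steady_bound /= s1N s1M addn1 NK MK (ltnW NK).
- apply: static; set s := (run eliminate _).1.
  by rewrite /= /steady_bound /= /s run_frame // -/s1 s1M MK.
Qed.

(** The table has [#|Omega|.+1] rows of four entries, and each entry has at least one digit. *)
Lemma input_size_ge : 4 * #|Omega|.+1 <= input_size (input_table Omega sgn).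
Proof.
rewrite /input_size /input_table big_cons big_map mulnS leq_add //.
  by rewrite !big_cons big_nil /bit_length; lia.
rewrite cardE -sum1_size mulnC big_distrl /=; apply: leq_sum => u _.
by rewrite !big_cons big_nil /bit_length; lia.
Qed.

End Time.

Local Open Scope ring_scope.

(** * Signs and logarithms of rank one solutions *)

Section SignedExponential.
Variable R : realType.
Implicit Types (e f : 'F_2) (t u : R).

(** The isomorphism from the additive group GF(2) x R onto the nonzero reals; it splits a product
    equation into one equation of (S) and one of (L). *)
Definition signed_exp e t : R := (-1) ^+ (e : nat) * expR t.

Lemma sign_F2D e f : (-1) ^+ (e + f)%R = (-1) ^+ (e : nat) * (-1) ^+ (f : nat) :> R.
Proof. by rewrite -exprD /= modn2 signr_odd. Qed.

Lemma signed_expD e f t u :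
  signed_exp (e + f) (t + u) = signed_exp e t * signed_exp f u.
Proof. by rewrite /signed_exp sign_F2D expRD mulrACA. Qed.

Lemma signed_exp_lt0 e t : (signed_exp e t < 0)%R%:R = e.
Proof.
case: e => [[|[|e]] He] //; rewrite /signed_exp /= ?expr0 ?expr1 ?mul1r ?mulN1r.
  by rewrite ltNge expR_ge0; apply: val_inj.
by rewrite oppr_lt0 expR_gt0; apply: val_inj.
Qed.

Lemma signed_expK t : t != 0 -> signed_exp (t < 0)%R%:R (ln `|t|) = t.
Proof.
move=> t0; rewrite /signed_exp lnK ?posrE ?normr_gt0 // [RHS]realEsign ?num_real //.
by case: (t < 0).
Qed.

End SignedExponential.

Lemma onto_card_gt (T : finType) (A : {set T}) n (f : T -> 'I_n.+1) :
  (forall i, exists2 u, u \in A & f u = i) -> (n < #|A|)%N.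
Proof.
move=> f_onto; apply: leq_trans (leq_imset_card f _).
apply: (@leq_trans #|[set: 'I_n.+1]|); first by rewrite cardsT card_ord.
apply/subset_leq_card/subsetP => i _; have [u Au <-] := f_onto i.
exact: imset_f.
Qed.

Section RankOne.
Variables (R : realType) (n1 n2 n3 : nat).
Variables (Omega : {set index3 n1 n2 n3}) (Q : index3 n1 n2 n3 -> R).
Hypothesis Q_neq0 : forall u, u \in Omega -> Q u != 0.
Hypothesis trivial_kernel : forall x y z,
  linear_solution Omega (fun=> 0 : R) (x, y, z) -> [/\ x = 0, y = 0 & z = 0].

(* An index i <> 1 that does not occur frees x_i; if 1 itself does not occur in
   the first coordinate, all other x_i may be shifted against all z_k. *)
Lemma occurs1 i : exists j k, (i, j, k) \in Omega.
Proof.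
apply: contrapT => nocc.
have neq i' j k : (i', j, k) \in Omega -> i' != i.
  by move=> ijk; apply/eqP => ei; apply: nocc; exists j, k; rewrite -ei.
have [i0|i0] := eqVneq i ord0.
  have [] := @trivial_kernel (\row_i' (i' != ord0)%:R) 0 (const_mx (-1)).
    split; rewrite ?mxE // => i' j k /neq; rewrite i0 !mxE => ->.
    by rewrite addr0 subrr.
  move=> _ _ /matrixP/(_ 0 ord0)/eqP; rewrite !mxE oppr_eq0 oner_eq0 //.
have [] := @trivial_kernel (delta_mx 0 i) 0 0.
  split; rewrite ?mxE //= 1?eq_sym ?(negPf i0) // => i' j k /neq/negPf ni.
  by rewrite !mxE ni /= !addr0.
by move=> /matrixP/(_ 0 i)/eqP; rewrite !mxE !eqxx oner_eq0.
Qed.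

Lemma occurs2 j : exists i k, (i, j, k) \in Omega.
Proof.
apply: contrapT => nocc.
have neq i j' k : (i, j', k) \in Omega -> j' != j.
  by move=> ijk; apply/eqP => ej; apply: nocc; exists i, k; rewrite -ej.
have [j0|j0] := eqVneq j ord0.
  have [] := @trivial_kernel 0 (\row_j' (j' != ord0)%:R) (const_mx (-1)).
    split; rewrite ?mxE // => i j' k /neq; rewrite j0 !mxE => ->.
    by rewrite add0r subrr.
  move=> _ _ /matrixP/(_ 0 ord0)/eqP; rewrite !mxE oppr_eq0 oner_eq0 //.
have [] := @trivial_kernel 0 (delta_mx 0 j) 0.
  split; rewrite ?mxE //= 1?eq_sym ?(negPf j0) // => i j' k /neq/negPf nj.
  by rewrite !mxE nj /= !addr0.
by move=> _ /matrixP/(_ 0 j)/eqP; rewrite !mxE !eqxx oner_eq0.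
Qed.

(** No [z] coordinate is normalized, so a unit vector is a kernel element without any case
    distinction. *)
Lemma occurs3 k : exists i j, (i, j, k) \in Omega.
Proof.
apply: contrapT => nocc.
have neq i j k' : (i, j, k') \in Omega -> k' != k.
  by move=> ijk; apply/eqP => ek; apply: nocc; exists i, j; rewrite -ek.
have [] := @trivial_kernel 0 0 (delta_mx 0 k).
  split; rewrite ?mxE // => i j k' /neq/negPf nk.
  by rewrite !mxE nk andbF !addr0.
by move=> _ _ /matrixP/(_ 0 k)/eqP; rewrite !mxE !eqxx oner_eq0.
Qed.

(** Every index occurs, so each coordinate projection of [Omega] is onto. *)
Lemma dims_lt_card : [/\ (n1 < #|Omega|)%N, (n2 < #|Omega|)%N & (n3 < #|Omega|)%N].
Proof.
split; [apply: (onto_card_gt (f := fun u => u.1.1)) => i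
       |apply: (onto_card_gt (f := fun u => u.1.2)) => j
       |apply: (onto_card_gt (f := fun u => u.2)) => k].
- by have [j [k]] := occurs1 i; exists (i, j, k).
- by have [i [k]] := occurs2 j; exists (i, j, k).
- by have [i [j]] := occurs3 k; exists (i, j, k).
Qed.

Lemma system_L_uniq s s' : system_L Omega Q s -> system_L Omega Q s' -> s = s'.
Proof.
case: s s' => [[x y] z] [[x' y'] z'] [x0 y0 S] [x'0 y'0 S'].
have [|] := @trivial_kernel (x - x') (y - y') (z - z').
  split; rewrite ?mxE ?x0 ?x'0 ?y0 ?y'0 ?subrr // => i j k ijk.
  have := S _ _ _ ijk; rewrite -(S' _ _ _ ijk) !mxE => e.
  rewrite -[X in _ = X](subrr (x 0 i + y 0 j + z 0 k)) {2}e; ring.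
by move=> /subr0_eq-> /subr0_eq-> /subr0_eq->.
Qed.

(** (S) codes a positive value by 1, whereas [signed_exp] reads 1 as a minus sign; a solution of (S)
    thus carries the signs of [- Q], which the minus on the third factor corrects. *)
Definition tensor_of (e : triple 'F_2 n1 n2 n3) (x : triple R n1 n2 n3) :
    triple R n1 n2 n3 :=
  (\row_i signed_exp (e.1.1 0 i) (x.1.1 0 i),
   \row_j signed_exp (e.1.2 0 j) (x.1.2 0 j),
   \row_k - signed_exp (e.2 0 k) (x.2 0 k)).

(* In (S) a sign is coded by 1 when it is positive, and the normalization
   a_1 = b_1 = 1 is coded by 0; flipping the signs of a and b, which fixes the
   tensor, reconciles the two: 0 codes + for a and b, but - for c. *)
Definition signs_of (s : triple R n1 n2 n3) : triple 'F_2 n1 n2 n3 :=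
  (\row_i (s.1.1 0 i < 0)%R%:R, \row_j (s.1.2 0 j < 0)%R%:R, \row_k (- s.2 0 k < 0)%R%:R).

Definition logs_of (s : triple R n1 n2 n3) : triple R n1 n2 n3 :=
  (\row_i ln `|s.1.1 0 i|, \row_j ln `|s.1.2 0 j|, \row_k ln `|s.2 0 k|).

Lemma tensor_ofP e x : system_S Omega Q e -> system_L Omega Q x ->
  rank_one_solution Omega Q (tensor_of e x) /\ normalized (tensor_of e x).
Proof.
case: e x => [[eps nu] eta] [[x y] z] [e0 n0 S] [x0 y0 L]; split; last first.
  by rewrite /= !mxE e0 n0 x0 y0 /signed_exp expR0 expr0 mulr1.
move=> i j k ijk; rewrite !mxE /= mulrN -!signed_expD S // L //.
rewrite -[LHS]opprK -[in LHS](@signed_expK _ (- Q (i, j, k))) ?oppr_eq0 ?Q_neq0 //.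
by rewrite normrN oppr_lt0; case: ifP.
Qed.

(** Each entry is a factor of some [Q u] with [u] in [Omega], which is nonzero. *)
Lemma rank_one_neq0 s : rank_one_solution Omega Q s ->
  [/\ forall i, s.1.1 0 i != 0, forall j, s.1.2 0 j != 0 & forall k, s.2 0 k != 0].
Proof.
case: s => [[a b] c] S.
have nz i j k : (i, j, k) \in Omega -> [&& a 0 i != 0, b 0 j != 0 & c 0 k != 0].
  by move=> ijk; have := Q_neq0 ijk; rewrite S // !mulf_eq0 !negb_or -andbA.
split=> [i|j|k] /=.
- by have [j [k /nz/and3P[]]] := occurs1 i.
- by have [i [k /nz/and3P[]]] := occurs2 j.
- by have [i [j /nz/and3P[]]] := occurs3 k.
Qed.

Lemma signs_logsP s : rank_one_solution Omega Q s -> normalized s ->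
  system_S Omega Q (signs_of s) /\ system_L Omega Q (logs_of s).
Proof.
move=> ro; have [a0 b0 c0] := rank_one_neq0 ro.
case: s ro a0 b0 c0 => [[a b] c] /= S a0 b0 c0 [a1 b1].
split; split; rewrite ?mxE /= ?a1 ?b1 ?ltr10 ?normr1 ?ln1 // => i j k ijk.
  have -> : (if 0 < Q (i, j, k) then 1 else 0) = (- Q (i, j, k) < 0)%R%:R :> 'F_2.
    by rewrite oppr_lt0; case: ifP.
  rewrite S // -mulrN !mxE.
  rewrite -[in RHS](signed_expK (a0 i)) -[in RHS](signed_expK (b0 j)).
  rewrite -[in RHS](@signed_expK _ (- c 0 k)) ?oppr_eq0 //.
  by rewrite -!signed_expD signed_exp_lt0.
by rewrite S // !mxE !normrM !lnM ?posrE ?mulr_gt0 ?normr_gt0.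
Qed.

Lemma signs_of_tensor e x : signs_of (tensor_of e x) = e.
Proof.
case: e => [[eps nu] eta]; congr (_, _, _); apply/rowP => l;
  by rewrite !mxE ?opprK signed_exp_lt0.
Qed.

Lemma tensor_of_signs_logs s : rank_one_solution Omega Q s ->
  tensor_of (signs_of s) (logs_of s) = s.
Proof.
move=> /rank_one_neq0; case: s => [[a b] c] /= [a0 b0 c0].
congr (_, _, _); apply/rowP => l; rewrite !mxE /= ?signed_expK //.
by rewrite -[in ln _]normrN signed_expK ?oppr_eq0 ?opprK.
Qed.

Lemma rank_one_normalize : (exists s, rank_one_solution Omega Q s) ->
  exists s, rank_one_solution Omega Q s /\ normalized s.
Proof.
move=> [s ro]; have [a0 b0 _] := rank_one_neq0 ro.
case: s ro a0 b0 => [[a b] c] /= S a0 b0.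
pose a1 := a 0 ord0; pose b1 := b 0 ord0.
(* The scalars multiply to 1, so the tensor is unchanged. *)
exists (a1^-1 *: a, b1^-1 *: b, (a1 * b1) *: c); split; last first.
  by rewrite /= !mxE !mulVf ?a0 ?b0.
move=> i j k ijk; rewrite S // !mxE; field.
by rewrite /a1 /b1 a0 b0.
Qed.

Lemma rank_one_system_L :
  (exists s, rank_one_solution Omega Q s) -> exists s, system_L Omega Q s.
Proof.
by move=> /rank_one_normalize[s [ro /(signs_logsP ro)[_ L]]]; exists (logs_of s).
Qed.

Lemma rank_one_system_S : (exists s, system_L Omega Q s) ->
  (exists s, rank_one_solution Omega Q s) <-> (exists s, system_S Omega Q s).
Proof.
move=> [x L]; split=> [/rank_one_normalize[s [ro /(signs_logsP ro)[S _]]]|[e S]].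
  by exists (signs_of s).
by exists (tensor_of e x); case: (tensor_ofP S L).
Qed.

(** As the solution [x] of (L) is the only one, [signs_of] and [tensor_of _ x] are mutually inverse
    between normalized rank one solutions and solutions of (S). *)
Lemma rank_one_unique : (exists s, system_L Omega Q s) ->
  (exists! s, rank_one_solution Omega Q s /\ normalized s) <->
  (exists! s, system_S Omega Q s).
Proof.
move=> [x L]; split=> -[].
  move=> s [[ro no] U]; have [S _] := signs_logsP ro no.
  exists (signs_of s); split=> // e Se.
  by rewrite (U _ (tensor_ofP Se L)) signs_of_tensor.
move=> e [S U]; exists (tensor_of e x); split; first exact: tensor_ofP.
move=> s [ro no]; have [Ss Ls] := signs_logsP ro no.
by rewrite (U _ Ss) (system_L_uniq L Ls) tensor_of_signs_logs.
Qed.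

End RankOne.

Theorem mainTheorem3 :
  exists time_bound : {poly nat},
  forall (R : realType) (n1 n2 n3 : nat)
    (Omega : {set index3 n1 n2 n3}) (Q : index3 n1 n2 n3 -> R),
  Omega != set0 ->
  (forall u, u \in Omega -> Q u != 0) ->
  (forall x y z, linear_solution Omega (fun=> 0 : R) (x, y, z) ->
     [/\ x = 0, y = 0 & z = 0]) ->
  [/\ (* (i) *)
      ~ (exists s, system_L Omega Q s) ->
      ~ (exists s, rank_one_solution Omega Q s),
      (* (ii) *)
      (exists s, system_L Omega Q s) ->
      ((exists s, rank_one_solution Omega Q s) <->
       (exists s, system_S Omega Q s)) /\
      ((exists s, rank_one_solution Omega Q s) ->
       ((exists! s, rank_one_solution Omega Q s /\ normalized s) <->
        (exists! s, system_S Omega Q s)))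
    & (* (iii) *)
      let input := input_table Omega (fun u => 0 < Q u) in
      let: (output, time) := run gaussian_elimination (load input) in
      [/\ says_solvable output <->
            exists s, system_S Omega Q s,
          says_unique output <->
            exists! s, system_S Omega Q s
        & (time <= time_bound.[input_size input])%N]].
Proof.
(* The bound depends on the program text alone, hence is chosen before all the data. *)
exists (time_poly gaussian_elimination) => R n1 n2 n3 Omega Q _ Q0 ker.
split.
- by move=> nL /(rank_one_system_L Q0 ker).
- move=> L; split; first exact: rank_one_system_S.
  by move=> _; apply: rank_one_unique.
move=> input; have [solv uniq] := gaussian_eliminationP Omega (fun u => 0 < Q u).
have size_ge : (4 * #|Omega|.+1 <= input_size input)%N by apply: input_size_ge.
have [d1 d2 d3] := dims_lt_card ker.
(* Here the number of unknowns is at most [3 * #|Omega|] and that of equations is [#|Omega| + 2],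
   both below [4 * #|Omega|.+1]. *)
have time_le : ((run gaussian_elimination (load input)).2 <=
    (time_poly gaussian_elimination).[input_size input])%N.
  by apply: gaussian_elimination_time; lia.
rewrite -/input in solv uniq.
have S_ext s : linear_solution Omega (fun u => (0 < Q u)%R%:R) s <-> system_S Omega Q s.
  by case: s => -[x y] z; split=> -[? ? S]; split=> // i j k /S ->; case: ifP.
case: (run _ _) solv uniq time_le => output time /= solv uniq time_le; split=> //.
- by rewrite solv; split=> -[s /S_ext]; exists s.
- rewrite uniq; split=> -[s [/S_ext S U]]; exists s; split=> // t /S_ext; exact: U.
Qed.
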